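(* For every type $t$ of homogeneous regular expression of depth 2, given a homogeneous regular expression $\mathcal{A}$ of type $+|$ or of type $*|$ of size $m$ and a homogeneous regular expression $\mathcal{B}$ of type $t$ of size $n$, one can decide whether $\mathcal{L}(\mathcal{A})\cap\mathcal{L}(\mathcal{B})\neq\emptyset$ in $\mathcal{O}(m+n)$ time.
   Context: Regular expressions over an integer alphabet $\Sigma$ of size polynomial in the input size are built from letters with concatenation $\circ$, union $|$, Kleene plus $+$ and Kleene star $*$, and viewed as rooted trees with letters at leaves; the size is the number of leaves. A regexp is homogeneous of depth 2 and type $t_1t_2$, $t_1\ne t_2\in\{\circ,|,+,*\}$, if its root is labelled $t_1$, all depth-1 inner nodes are labelled $t_2$, their children are leaves, and the tree has depth 3 (children of the root may be leaves). A regexp of type $+|$ is $[c_1|\cdots|c_r]^+$ with language $\{c_1,\dots,c_r\}^+$; of type $*|$ is $[c_1|\cdots|c_r]^*$ with language $\{c_1,\dots,c_r\}^*$. *)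

(* Defs.v *)
From mathcomp Require Import all_boot.

Set Implicit Arguments.
Unset Strict Implicit.
Unset Printing Implicit Defensive.

Inductive op := OpConcat | OpUnion | OpPlus | OpStar.

Inductive regexp (T : Type) :=
| Letter of T
| Concat of seq (regexp T)
| Union of seq (regexp T)
| Plus of regexp T
| Star of regexp T.

Section Regexp.
Variable T : Type.
Implicit Types (e : regexp T) (L : seq T -> Prop) (x : seq T).

Definition lang_eps x := x = [::].
Definition lang_cat L1 L2 x := exists y z, [/\ x = y ++ z, L1 y & L2 z].
Definition lang_pow L n := iter n (lang_cat L) lang_eps.

Fixpoint lang e : seq T -> Prop :=
  match e with
  | Letter a => fun x => x = [:: a]
  | Concat es => foldr (fun f L => lang_cat (lang f) L) lang_eps es
  | Union es => foldr (fun f L x => lang f x \/ L x) (fun=> False) es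
  | Plus f => fun x => exists2 n, 0 < n & lang_pow (lang f) n x
  | Star f => fun x => exists n, lang_pow (lang f) n x
  end.

Definition children e : seq (regexp T) :=
  match e with
  | Letter _ => [::]
  | Concat es | Union es => es
  | Plus f | Star f => [:: f]
  end.

Definition labelled (o : op) e : bool :=
  match o, e with
  | OpConcat, Concat _ | OpUnion, Union _ | OpPlus, Plus _ | OpStar, Star _ =>
      true
  | _, _ => false
  end.

Definition is_leaf e : bool := if e is Letter _ then true else false.

Fixpoint leaves e : nat :=
  match e with
  | Letter _ => 1
  | Concat es | Union es => sumn (map leaves es)
  | Plus f | Star f => leaves f
  end.

(* The depth counts nodes, not edges: a letter alone has depth 1. *)
Fixpoint depth e : nat :=
  match e with
  | Letter _ => 1
  | Concat es | Union es => (foldr maxn 0 (map depth es)).+1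
  | Plus f | Star f => (depth f).+1
  end.

(* Every leaf of the tree is a letter: no concatenation or union is empty. *)
Fixpoint well_formed e : bool :=
  match e with
  | Letter _ => true
  | Concat es | Union es => (0 < size es) && all well_formed es
  | Plus f | Star f => well_formed f
  end.

(* "Homogeneous of depth 2 and type t1 t2"; the 2 counts the levels of
   operators, so the tree has depth 3 once the letters are counted. *)
Definition homogeneous (t1 t2 : op) e : bool :=
  [&& well_formed e, labelled t1 e, depth e == 3
    & all (fun c => is_leaf c || labelled t2 c && all is_leaf (children c))
          (children e)].

End Regexp.

(* A regular expression is presented to a machine as the preorder listing of
   its tree, two words per node: the label of the node, followed by the letter
   for a leaf and by the number of children for an inner node. *)
Fixpoint encode (sigma : nat) (e : regexp 'I_sigma) : seq nat :=
  match e with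
  | Letter a => [:: 0; val a]
  | Concat es => 1 :: size es :: flatten (map (@encode sigma) es)
  | Union es => 2 :: size es :: flatten (map (@encode sigma) es)
  | Plus f => 3 :: 1 :: encode f
  | Star f => 4 :: 1 :: encode f
  end.

(* Unit-cost word RAM with word length w: registers and memory cells hold
   integers below 2 ^ w, arithmetic is modulo 2 ^ w, memory is addressed by
   words.  A program mentions only finitely many registers. *)
Inductive instr :=
| Const (r c : nat)        (* r := c *)
| Add (r r1 r2 : nat)      (* r := r1 + r2 *)
| Sub (r r1 r2 : nat)      (* r := r1 - r2 *)
| Read (r ra : nat)        (* r := mem[ra] *)
| Write (ra r : nat)       (* mem[ra] := r *)
| JmpLt (r1 r2 l : nat)    (* if r1 < r2 then goto l *)
| JmpEq (r1 r2 l : nat).   (* if r1 = r2 then goto l *)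

Definition program := seq instr.

Record config := Config { pc : nat; reg : nat -> nat; mem : nat -> nat }.

Definition exec_instr (w : nat) (i : instr) (c : config) : config :=
  let: Config p R M := c in
  let set r v := Config p.+1 [eta R with r |-> v] M in
  match i with
  | Const r v => set r (v %% 2 ^ w)
  | Add r r1 r2 => set r ((R r1 + R r2) %% 2 ^ w)
  | Sub r r1 r2 => set r ((R r1 + 2 ^ w - R r2) %% 2 ^ w)
  | Read r ra => set r (M (R ra))
  | Write ra r => Config p.+1 R [eta M with R ra |-> R r]
  | JmpLt r1 r2 l => Config (if R r1 < R r2 then l else p.+1) R M
  | JmpEq r1 r2 l => Config (if R r1 == R r2 then l else p.+1) R M
  end.

(* The machine halts when the program counter leaves the program. *)
Definition halted (P : program) (c : config) : bool := size P <= pc c.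

Definition step (w : nat) (P : program) (c : config) : config :=
  if halted P c then c
  else exec_instr w (nth (Const 0 0) P (pc c)) c.

(* The memory starts with the input; the other cells hold arbitrary words. *)
Definition initial_mem (w : nat) (input : seq nat) (M : nat -> nat) : Prop :=
  (forall i, M i < 2 ^ w) /\ (forall i, i < size input -> M i = nth 0 input i).

(* On the given input, P halts within t steps, and register 0 is then nonzero
   (accept) if and only if Q holds. *)
Definition decides_within (w : nat) (P : program) (input : seq nat) (Q : Prop)
    (t : nat) : Prop :=
  forall M, initial_mem w input M ->
  let final := iter t (step w P) (Config 0 (fun=> 0) M) in
  halted P final /\ (reg final 0 <> 0 <-> Q).

(* Main.v *)
(* The words of L(A) are those over the set S of letters of A, the empty word
   being allowed only for a star.  Whether a regexp produces the empty word
   (nullable) and whether it produces a nonempty word over S (productive) are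
   computed together by structural recursion, from nothing but the numbers of
   nullable, productive, and nullable or productive children of each node; so
   one program, which scans A once to tabulate S and then B once to count,
   serves every type t1 t2.  The memory outside the input is not initialised,
   so a table entry is a pointer into the input, validated by looking at the
   letter it points to. *)
Require Import Defs.
From mathcomp Require Import all_boot zify.
From Stdlib Require Import FunctionalExtensionality.

Set Implicit Arguments.
Unset Strict Implicit.
Unset Printing Implicit Defensive.

(** * Words over a set of letters in the language of a regexp *)

Section Nullable.
Variable T : Type.
Implicit Types (e f : regexp T) (L : seq T -> Prop) (x : seq T).

(** The hypotheses on the members of a list form a [foldr] conjunction, which unfolds in step with
    [lang] in an induction on that list. *)
Fixpoint regexp_nested_ind (P : regexp T -> Prop)
    (PL : forall a, P (Letter a))
    (PC : forall es, foldr (fun e => and (P e)) True es -> P (Concat es))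
    (PU : forall es, foldr (fun e => and (P e)) True es -> P (Union es))
    (PP : forall e, P e -> P (Plus e))
    (PS : forall e, P e -> P (Star e)) e : P e :=
  let ind := regexp_nested_ind PL PC PU PP PS in
  let fix ind_seq es : foldr (fun e => and (P e)) True es :=
    if es is e :: es' then conj (ind e) (ind_seq es') else I in
  match e with
  | Letter a => PL a
  | Concat es => PC es (ind_seq es)
  | Union es => PU es (ind_seq es)
  | Plus f => PP f (ind f)
  | Star f => PS f (ind f)
  end.

Fixpoint nullable e : bool :=
  match e with
  | Letter _ => false
  | Concat es => all nullable es
  | Union es => has nullable es
  | Plus f => nullable f
  | Star _ => true
  end.

Lemma lang_pow_nil L n : L [::] -> lang_pow L n [::].
Proof. by move=> L0; elim: n => //= n IH; exists [::], [::]. Qed.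

Lemma lang_pow1 L x : L x -> lang_pow L 1 x.
Proof. by move=> Lx; exists x, [::]; rewrite cats0. Qed.

Lemma nullableP e : lang e [::] <-> nullable e.
Proof.
elim/regexp_nested_ind: e => [a|es|es|e IH|e _] //=.
- elim: es => [|e es IHes] //= [IHe {}/IHes IHes]; split.
    by move=> [[|a y] [[|b z] [//= _ /IHe -> /IHes ->]]].
  by move=> /andP [/IHe he /IHes hes]; exists [::], [::].
- elim: es => [|e es IHes] //= [IHe {}/IHes IHes].
  by split=> [[/IHe -> //|/IHes ->]|/orP [/IHe|/IHes]]; rewrite ?orbT; auto.
- split=> [[[//|n] _ [[|a y] [[|b z] [//= _ /IH]]]] //|/IH e0].
  by exists 1 => //; exact: lang_pow_nil.
- by split=> // _; exists 0.
Qed.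

Variable S : pred T.

Fixpoint productive e : bool :=
  match e with
  | Letter a => S a
  | Concat es => all (fun f => nullable f || productive f) es && has productive es
  | Union es => has productive es
  | Plus f | Star f => productive f
  end.

Definition meets L := exists2 x, L x & all S x.
Definition meets_nonempty L := exists x, [/\ L x, x <> [::] & all S x].

Lemma meetsE L : meets L <-> L [::] \/ meets_nonempty L.
Proof.
split=> [[[|a x] Lx Sx]|[L0|[x [Lx _ Sx]]]]; [by left| |by exists [::]|by exists x].
by right; exists (a :: x).
Qed.

Lemma meets_cat L1 L2 : meets (lang_cat L1 L2) <-> meets L1 /\ meets L2.
Proof.
split=> [[_ [y [z [-> L1y L2z]]]]|[[y L1y Sy] [z L2z Sz]]].
  by rewrite all_cat => /andP [Sy Sz]; split; [exists y|exists z].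
by exists (y ++ z); [exists y, z|rewrite all_cat Sy].
Qed.

Lemma meets_nonempty_cat L1 L2 : meets_nonempty (lang_cat L1 L2) <->
  meets_nonempty L1 /\ meets L2 \/ meets L1 /\ meets_nonempty L2.
Proof.
split=> [[_ [[y [z [-> L1y L2z]]]]]|].
  rewrite all_cat => yz0 /andP [Sy Sz]; case: y => [|a y] in L1y Sy yz0 *.
    by right; split; [exists [::]|exists z].
  by left; split; [exists (a :: y)|exists z].
move=> [[[y [L1y y0 Sy]] [z L2z Sz]]|[[y L1y Sy] [z [L2z z0 Sz]]]];
  exists (y ++ z); split; rewrite ?all_cat ?Sy //; try by exists y, z.
  by case: y y0 {L1y Sy}.
by case: y {L1y Sy}.
Qed.

(** A nonempty product has a nonempty factor, so iteration creates no productivity; hence [Plus] and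
    [Star] share a clause in [productive]. *)
Lemma meets_nonempty_pow L n :
  meets_nonempty (lang_pow L n) -> meets_nonempty L.
Proof.
elim: n => [[x [-> //]]|n IH] /= /meets_nonempty_cat [[] //|[_ /IH //]].
Qed.

Lemma productiveP e : meets_nonempty (lang e) <-> productive e.
Proof.
elim/regexp_nested_ind: e => [a|es|es|e IH|e IH] /=.
- split=> [[x [-> _ /= /andP [//]]]|Sa]; exists [:: a]; split=> //=.
  by rewrite Sa.
- move=> IH; pose L := foldr (fun f => lang_cat (lang f)) (@lang_eps T) es.
  pose all_ok := all (fun f => nullable f || productive f) es.
  (* Both equivalences go through the list together, since [meets_nonempty_cat] involves [meets] of
     the other factor. *)
  suff [] : (meets L <-> all_ok) /\ (meets_nonempty L <-> all_ok && has productive es) by [].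
  rewrite {}/L {}/all_ok; elim: es IH => [|e es IHes] /=.
    by move=> _; split; split=> //; [exists [::]|move=> [x [->]]].
  move=> [IHe {}/IHes [IHm IHn]].
  have He : meets (lang e) <-> nullable e || productive e.
    by rewrite meetsE IHe nullableP; split=> /orP.
  rewrite meets_cat meets_nonempty_cat IHm IHn He IHe.
  case: (nullable e); case: (productive e); case: all; case: has => /=;
    split; intuition (by []).
- elim: es => [|e es IHes] /=; first by split=> // -[x []].
  move=> [IHe {}/IHes IHes].
  split=> [[x [[ex|esx] x0 Sx]]|/orP [/IHe|/IHes] [x [ex x0 Sx]]].
  + by apply/orP; left; apply/IHe; exists x.
  + by apply/orP; right; apply/IHes; exists x.
  + by exists x; split=> //; left.
  + by exists x; split=> //; right.
- rewrite -IH; split=> [[x [[n _ ex] x0 Sx]]|[x [ex x0 Sx]]].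
    by apply: (@meets_nonempty_pow _ n); exists x.
  by exists x; split=> //; exists 1 => //; exact: lang_pow1.
- rewrite -IH; split=> [[x [[n ex] x0 Sx]]|[x [ex x0 Sx]]].
    by apply: (@meets_nonempty_pow _ n); exists x.
  by exists x; split=> //; exists 1; exact: lang_pow1.
Qed.

End Nullable.

(** * The machine *)

(* Registers:
   0       the answer
   1, 2, 4, 9   the constants 1, 2, 4, 0
   3       2 ^ w - 1; the table of the letters of A is indexed downwards from
           this address
   5       2 * m + 3, the address of the last word of A
   6       the reading head
   7, 8    scratch
   10, 11  label and number of children of the root of B
   12, 13, 14   how many children so far are nullable, productive, either
   15      how many children so far
   16, 17  label and number of leaves of the current child; a child which is a
           letter is treated as a node with one leaf
   18, 19  how many leaves of the current child so far are letters of A, and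
           how many leaves so far *)
Definition decider : program :=
  [:: Const 1 1; Const 2 2; Const 4 4; Defs.Sub 3 9 1; Const 7 3;
      Read 5 7; Add 5 5 5; Add 5 5 7; Const 6 4;
   (* 9: a letter of A *)
      Add 7 6 1; Read 8 7; Write 6 8; Defs.Sub 7 3 8; Write 7 6; Add 6 6 2;
      JmpLt 6 5 9;
   (* 16: the root of B *)
      Read 10 6; Add 7 6 1; Read 11 7; Add 6 6 2;
   (* 20: a child of the root of B *)
      Read 16 6; Const 17 1; Const 18 0; Const 19 0; JmpEq 16 9 28;
      Add 7 6 1; Read 17 7; Add 6 6 2;
   (* 28: a leaf of the child *)
      Add 7 6 1; Read 8 7; Defs.Sub 7 3 8; Read 7 7; JmpLt 7 4 38; JmpLt 5 7 38;
      Read 7 7; JmpLt 7 8 38; JmpLt 8 7 38; Add 18 18 1;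
   (* 38: the next leaf *)
      Add 6 6 2; Add 19 19 1; JmpLt 19 17 28;
   (* 41: the counts for the child *)
      JmpEq 18 9 47; JmpLt 1 16 44; JmpLt 18 17 47;
      Add 13 13 1; Add 14 14 1; JmpEq 9 9 49;
   (* 47: the child is not productive *)
      JmpLt 16 4 51; Add 14 14 1;
   (* 49: the child is already counted in register 14 *)
      JmpLt 16 4 51; Add 12 12 1;
   (* 51: the next child *)
      Add 15 15 1; JmpLt 15 11 20;
   (* 53: is B productive *)
      JmpEq 13 9 56; JmpLt 1 10 63; JmpEq 14 11 63;
   (* 56: can A and B both produce the empty word *)
      Read 7 9; JmpLt 7 4 64; JmpEq 10 4 63; JmpEq 10 1 62; JmpLt 9 12 63;
      JmpEq 9 9 64;
   (* 62: B is a concatenation *)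
      JmpLt 12 11 64;
   (* 63: accept *)
      Const 0 1].

Section Machine.
Variables (w : nat) (P : program).
Implicit Types (c : config) (b : bool) (s : seq nat) (M : nat -> nat).

Definition halts c t b :=
  let final := iter t (step w P) c in halted P final /\ reg final 0 = b.

Lemma halts_step c t b : halts (step w P c) t b -> halts c t.+1 b.
Proof. by rewrite /halts iterSr. Qed.

(** A halted configuration is fixed by [step]. Time bounds thus act as budgets, which branches of
    different lengths can share. *)
Lemma halts_weaken c t t' b : t <= t' -> halts c t b -> halts c t' b.
Proof.
move=> /subnK <- [ht hb]; elim: (t' - t) => // k; rewrite addSn => -[hk hbk].
by rewrite /halts iterS /step hk.
Qed.

(* The registers beyond the end of the list [s] are zero. *)
Definition state pc s M := Config pc (nth 0 s) M.

Lemma state_step pc s M i t b : onth P pc = Some i ->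
  halts (exec_instr w i (state pc s M)) t b -> halts (state pc s M) t.+1 b.
Proof.
move=> Pi h; apply: halts_step.
have pc_lt : pc < size P by case: ltnP Pi => // /onth_default ->.
by rewrite /step /halted leqNgt pc_lt (onth_nth _ _ _ _ Pi).
Qed.

(** Keeps the registers an explicit list, so that [/=] evaluates every register access during
    symbolic execution. *)
Lemma set_reg s r v :
  [eta nth 0 s with r |-> v] = nth 0 (set_nth 0 s r v) :> (nat -> nat).
Proof. by apply: functional_extensionality => i; rewrite nth_set_nth. Qed.

Lemma exec_const pc s M r v t b : onth P pc = Some (Const r v) -> v < 2 ^ w ->
  halts (state pc.+1 (set_nth 0 s r v) M) t b -> halts (state pc s M) t.+1 b.
Proof. by move=> Pi v_lt h; apply: (state_step Pi); rewrite /= modn_small // set_reg. Qed.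

Lemma exec_add pc s M r r1 r2 t b : onth P pc = Some (Add r r1 r2) ->
    nth 0 s r1 + nth 0 s r2 < 2 ^ w ->
    halts (state pc.+1 (set_nth 0 s r (nth 0 s r1 + nth 0 s r2)) M) t b ->
  halts (state pc s M) t.+1 b.
Proof. by move=> Pi v_lt h; apply: (state_step Pi); rewrite /= modn_small // set_reg. Qed.

Lemma exec_sub pc s M r r1 r2 t b : onth P pc = Some (Defs.Sub r r1 r2) ->
    nth 0 s r2 <= nth 0 s r1 < 2 ^ w ->
    halts (state pc.+1 (set_nth 0 s r (nth 0 s r1 - nth 0 s r2)) M) t b ->
  halts (state pc s M) t.+1 b.
Proof.
move=> Pi /andP [le_r lt_w] h; apply: (state_step Pi) => /=.
rewrite addnC -addnBA // modnDl modn_small ?set_reg //.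
exact: leq_ltn_trans (leq_subr _ _) lt_w.
Qed.

(** Serves to compute 0 - 1 = 2 ^ w - 1, by which the program obtains the largest word without
    knowing [w]. *)
Lemma exec_sub_wrap pc s M r r1 r2 t b : onth P pc = Some (Defs.Sub r r1 r2) ->
    nth 0 s r1 < nth 0 s r2 ->
    halts (state pc.+1 (set_nth 0 s r (nth 0 s r1 + 2 ^ w - nth 0 s r2)) M) t b ->
  halts (state pc s M) t.+1 b.
Proof.
move=> Pi lt_r h; apply: (state_step Pi) => /=.
by rewrite modn_small ?set_reg //; have := expn_gt0 2 w; lia.
Qed.

Lemma exec_read pc s M r ra t b : onth P pc = Some (Read r ra) ->
    halts (state pc.+1 (set_nth 0 s r (M (nth 0 s ra))) M) t b ->
  halts (state pc s M) t.+1 b.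
Proof. by move=> Pi h; apply: (state_step Pi); rewrite /= set_reg. Qed.

Lemma exec_write pc s M ra r t b : onth P pc = Some (Write ra r) ->
    halts (state pc.+1 s [eta M with nth 0 s ra |-> nth 0 s r]) t b ->
  halts (state pc s M) t.+1 b.
Proof. by move=> Pi; apply: (state_step Pi). Qed.

Lemma exec_jmplt pc s M r1 r2 l t b : onth P pc = Some (JmpLt r1 r2 l) ->
    halts (state (if nth 0 s r1 < nth 0 s r2 then l else pc.+1) s M) t b ->
  halts (state pc s M) t.+1 b.
Proof. by move=> Pi; apply: (state_step Pi). Qed.

Lemma exec_jmpeq pc s M r1 r2 l t b : onth P pc = Some (JmpEq r1 r2 l) ->
    halts (state (if nth 0 s r1 == nth 0 s r2 then l else pc.+1) s M) t b ->
  halts (state pc s M) t.+1 b.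
Proof. by move=> Pi; apply: (state_step Pi). Qed.

End Machine.

(** One step of symbolic execution: [reflexivity] fetches the instruction at the concrete program
    counter and so selects the rule. Range conditions come first among the remaining goals;
    subtraction is taken to be exact. *)
Ltac exec :=
  first [ apply: exec_const; [reflexivity | | ]
        | apply: exec_add; [reflexivity | | ]
        | apply: exec_sub; [reflexivity | | ]
        | apply: exec_read; [reflexivity | ]
        | apply: exec_write; [reflexivity | ]
        | apply: exec_jmplt; [reflexivity | ]
        | apply: exec_jmpeq; [reflexivity | ] ]; rewrite /=.

Definition holds (M : nat -> nat) p s :=
  forall i, i < size s -> M (p + i) = nth 0 s i.

Lemma holds_cat M p s1 s2 :
  holds M p (s1 ++ s2) <-> holds M p s1 /\ holds M (p + size s1) s2.
Proof.
split=> [h|[h1 h2] i]; first split=> i i_lt.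
- by rewrite h ?nth_cat ?i_lt // size_cat; lia.
- rewrite -addnA h ?size_cat ?nth_cat; last by lia.
  by rewrite ltnNge leq_addr addKn.
- rewrite size_cat nth_cat => i_lt; case: ltnP => [/h1 //|i_ge].
  by rewrite -h2 -?addnA ?subnKC //; lia.
Qed.

Definition encode_leaves (l : seq nat) := flatten [seq [:: 0; a] | a <- l].

Lemma size_encode_leaves l : size (encode_leaves l) = 2 * size l.
Proof. by elim: l => //= a l; rewrite /encode_leaves /= => ->; lia. Qed.

(** * Correctness of the machine *)

Section Encodings.
Variables (in_A : pred nat) (sigma : nat).
Implicit Types (e : regexp 'I_sigma) (es : seq (regexp 'I_sigma)).

Definition label e :=
  match e with
  | Letter _ => 0
  | Concat _ => 1
  | Union _ => 2
  | Plus _ => 3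
  | Star _ => 4
  end.

Definition letter_of_A (a : 'I_sigma) := in_A a.

Lemma encode_node e : ~~ is_leaf e -> encode e =
  [:: label e, size (children e) & flatten (map (@encode sigma) (children e))].
Proof. by case: e => //= e _; rewrite cats0. Qed.

(** One formula in the counts for all operators, as the program evaluates it: a [Plus] is tested
    like a union with one child. *)
Lemma nullable_node e : ~~ is_leaf e -> nullable e = (label e == 4) ||
  (if label e == 1 then count (@nullable _) (children e) == size (children e)
   else 0 < count (@nullable _) (children e)).
Proof. by case: e => //= *; rewrite ?all_count ?has_count ?addn0 ?lt0b. Qed.

(** Labels above 1 need just one productive child; a concatenation also needs every factor to offer
    some word over the letters of A. *)
Lemma productive_node e : ~~ is_leaf e ->
  let pr := productive letter_of_A in
  productive letter_of_A e = (0 < count pr (children e)) &&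
    ((1 < label e) ||
     (count (fun f => nullable f || pr f) (children e) == size (children e))).
Proof.
case: e => //= *; rewrite ?all_count ?has_count ?addn0 ?lt0b ?andbT //.
exact: andbC.
Qed.

Lemma all_is_leaf es : all (@is_leaf _) es -> exists l, es = map (@Letter _) l.
Proof.
elim: es => [|[a| | | |] es IH] //=; first by exists [::].
by move=> /IH [l ->]; exists (a :: l).
Qed.

Lemma encode_letters (l : seq 'I_sigma) :
  flatten (map (@encode _) (map (@Letter _) l)) = encode_leaves (map val l).
Proof. by rewrite /encode_leaves -!map_comp. Qed.

Definition shallow e :=
  is_leaf e || (0 < size (children e)) && all (@is_leaf _) (children e).

(** A letter obeys the formulas of an inner node when taken as a node with label 0, one leaf and an
    empty header [s]. This lets the program treat all children of the root of B alike. *)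
Lemma shallowP e : shallow e -> exists (l : seq nat) s,
  [/\ encode e = s ++ encode_leaves l,
      s = if is_leaf e then [::] else [:: label e; size l],
      is_leaf e -> size l = 1,
      l != [::] & all (ltn^~ sigma) l] /\
  [/\ nullable e = (label e == 4),
      productive letter_of_A e =
        (0 < count in_A l) && ((1 < label e) || (size l <= count in_A l)) &
      leaves e = size l].
Proof.
case: (boolP (is_leaf e)) => [|leaf_e].
  case: e => // a _ _; exists [:: val a], [::]; split; split=> //=.
    by rewrite ltn_ord.
  by rewrite addn0 lt0b /letter_of_A; case: (in_A a).
rewrite /shallow (negbTE leaf_e) /= => /andP [ch0 /all_is_leaf [l def_l]].
exists (map val l), [:: label e; size (map val l)]; split; split=> //.
- by rewrite encode_node // def_l encode_letters !size_map.
- by move: ch0; rewrite def_l; case: l {def_l}.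
- by apply/allP => _ /mapP [a _ ->]; exact: ltn_ord.
- rewrite nullable_node // def_l count_map size_map.
  rewrite (@eq_count _ _ pred0) // count_pred0.
  (* Nonemptiness matters here: an empty concatenation would be nullable. *)
  rewrite lt0n; move: ch0; rewrite def_l size_map; case: (size l) => //= n _.
  by case: ifP; rewrite orbF.
- rewrite productive_node //= def_l !count_map !size_map.
  by rewrite eqn_leq count_size.
- rewrite size_map; case: e leaf_e def_l {ch0} => //= [es|es|e|e] _.
  + by move=> ->; elim: l => //= a l ->.
  + by move=> ->; elim: l => //= a l ->.
  + by case: l => [|a []] // [->].
  + by case: l => [|a []] // [->].
Qed.

End Encodings.

Arguments letter_of_A in_A {sigma} a.

Lemma shallow_leaves_gt0 sigma (e : regexp 'I_sigma) : shallow e -> 0 < leaves e.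
Proof. by move=> /(shallowP pred0) [l [s [[_ _ _ l0 _] [_ _ ->]]]]; case: l l0. Qed.

(** Each leaf takes two words, and the two words of the header are charged to the first leaf. *)
Lemma size_encode_shallow sigma (e : regexp 'I_sigma) :
  shallow e -> size (encode e) <= 4 * leaves e.
Proof.
move=> /(shallowP pred0) [l [s [[-> -> leaf_l l0 _] [_ _ ->]]]].
rewrite size_cat size_encode_leaves; case: ifP => _ /=; first by lia.
by case: l l0 {leaf_l} => //= *; lia.
Qed.

Lemma size_encode_children sigma (es : seq (regexp 'I_sigma)) : all (@shallow _) es ->
  size (flatten (map (@encode _) es)) <= 4 * sumn (map (@leaves _) es).
Proof.
elim: es => //= e es IH /andP [/size_encode_shallow le_e /IH le_es].
by rewrite size_cat; lia.
Qed.

(** * Scanning B against the table of letters of A *)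

Section Decider.
Variables (w m : nat) (in_A : pred nat).
Hypothesis w_ge4 : 4 < 2 ^ w.

(** The right-hand side is literally the test made by the program, so entries for letters outside A
    may hold anything that fails it. *)
Definition table (M : nat -> nat) := forall a, a < 2 ^ w ->
  let q := M (2 ^ w - 1 - a) in
  in_A a = [&& 4 <= q, q <= 2 * m + 3 & M q == a].

(** [T] and [S] describe the root of B, [cE], [cN], [cEN] and [i] count its children, and [t],
    [cnt], [cn] and [j] belong to the current child. *)
Definition tree_state pc p x7 x8 T S cE cN cEN i t cnt cn j M :=
  state pc [:: 0; 1; 2; 2 ^ w - 1; 4; 2 * m + 3; p; x7; x8; 0; T; S;
               cE; cN; cEN; i; t; cnt; cn; j] M.

Lemma exec_leaves (l : seq nat) M p x7 x8 T S cE cN cEN i t cnt cn j k b :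
    table M -> l != [::] -> all (ltn^~ (2 ^ w)) l ->
    holds M p (encode_leaves l) -> p + 2 * size l < 2 ^ w ->
    j + size l = cnt -> cnt < 2 ^ w -> cn <= j ->
    (forall x7 x8, halts w decider
      (tree_state 41 (p + 2 * size l) x7 x8 T S cE cN cEN i t cnt
         (cn + count in_A l) cnt M) k b) ->
  halts w decider
    (tree_state 28 p x7 x8 T S cE cN cEN i t cnt cn j M) (13 * size l + k) b.
Proof.
move=> tM; elim: l p x7 x8 cn j => // a l IH p x7 x8 cn j _ /= /andP [a_lt l_lt].
move=> hM p_lt def_cnt cnt_lt cn_le hk.
have hMl : holds M (p + 2) (encode_leaves l).
  by move: hM; rewrite (holds_cat _ _ [:: 0; a]) => -[].
have Ma : M (p + 1) = a by rewrite hM.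
(* At most ten instructions look the letter up, and three advance the loop. *)
have -> : 13 * (size l).+1 + k = (10 + (3 + (13 * size l + k))) by lia.
(* All outcomes of the lookup meet at this address and differ only in the count. *)
have next x7' x8' cn' : cn' = cn + in_A a -> halts w decider
   (tree_state 38 p x7' x8' T S cE cN cEN i t cnt cn' j M)
   (3 + (13 * size l + k)) b.
  move=> def_cn'; rewrite /tree_state.
  exec; first by lia.
  exec; first by lia.
  exec.
  case: l => [|a' l] in IH l_lt hM p_lt def_cnt hk hMl *.
    rewrite (_ : (_ < _) = false) /=; last by move: def_cnt => /=; lia.
    move: (hk x7' x8'); rewrite /tree_state /= !addn0 -def_cn'.
    by rewrite (_ : j + 1 = cnt) //; apply: halts_weaken; lia.
  rewrite (_ : (_ < _) = true) /=; last by move: def_cnt => /=; lia.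
  apply: IH => //; try by move: p_lt def_cnt => /=; lia.
  move=> y7 y8; move: (hk y7 y8) => /=; rewrite def_cn' -[cn + in_A a + _]addnA.
  by rewrite (_ : p + 2 + 2 * (size l).+1 = p + 2 * (size l).+2) //; lia.
have := tM a a_lt; cbv zeta => in_Aa.
rewrite /tree_state.
exec; first by lia.
exec.
rewrite Ma.
exec; first by lia.
exec.
exec.
case: (ltnP _ 4) in_Aa => [_|q4] in_Aa.
  by apply: halts_weaken (next _ _ _ _); [lia|rewrite in_Aa addn0].
exec.
case: (ltnP (2 * m + 3)) in_Aa => [_|qm] in_Aa.
  by apply: halts_weaken (next _ _ _ _); [lia|rewrite in_Aa addn0].
exec.
exec.
case: (ltngtP _ a) in_Aa => [_|lt_a|eq_a] in_Aa.
- by apply: halts_weaken (next _ _ _ _); [lia|rewrite in_Aa addn0].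
- exec; rewrite lt_a.
  by apply: halts_weaken (next _ _ _ _); [lia|rewrite in_Aa addn0].
- exec; rewrite eq_a ltnn.
  exec; first by lia.
  by apply: halts_weaken (next _ _ _ _); [lia|rewrite in_Aa].
Qed.

Lemma exec_counts M p x7 x8 T S cE cN cEN i t cnt cn j k b :
    let n := t == 4 in
    let pr := (0 < cn) && ((1 < t) || (cnt <= cn)) in
    cE <= i -> cN <= i -> cEN <= i -> i.+1 < 2 ^ w ->
    halts w decider
      (tree_state 52 p x7 x8 T S (cE + n) (cN + pr) (cEN + (n || pr)) i.+1
         t cnt cn j M) k b -> t <= 4 ->
  halts w decider
    (tree_state 41 p x7 x8 T S cE cN cEN i t cnt cn j M) (10 + k) b.
Proof.
move=> n pr cE_le cN_le cEN_le i_lt hk t_le.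
(* The program is followed backwards from the point where all branches meet, each address receiving
   its remaining budget. *)
have next cE' cN' cEN' :
    cE' = cE + n -> cN' = cN + pr -> cEN' = cEN + (n || pr) ->
    halts w decider
      (tree_state 51 p x7 x8 T S cE' cN' cEN' i t cnt cn j M) k.+1 b.
  move=> -> -> ->; rewrite /tree_state; exec; first by lia.
  by rewrite addn1.
have next_nullable cN' cEN' :
    cN' = cN + pr -> cEN' = cEN + (n || pr) ->
    halts w decider
      (tree_state 49 p x7 x8 T S cE cN' cEN' i t cnt cn j M) k.+3 b.
  move=> hN hEN; rewrite /tree_state; exec; case: ltnP => t4.
    by apply: halts_weaken (next _ _ _ _ hN hEN); lia.
  by exec; [lia|apply: next hN hEN; lia].
have next_unproductive : pr = false -> halts w decider
    (tree_state 47 p x7 x8 T S cE cN cEN i t cnt cn j M) (k.+4.+1) b.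
  move=> hpr; rewrite /tree_state; exec; case: ltnP => t4.
    by apply: halts_weaken (next _ _ _ _ _ _); lia.
  by exec; [lia|apply: next_nullable; lia].
have next_productive : pr = true -> halts w decider
    (tree_state 44 p x7 x8 T S cE cN cEN i t cnt cn j M) (k.+4.+2) b.
  move=> hpr; rewrite /tree_state; exec; first by lia.
  by exec; [lia|exec; apply: next_nullable; lia].
rewrite /tree_state; exec; case: eqP => [cn0|cn_pos].
  by apply: halts_weaken (next_unproductive _); lia.
exec; case: ltnP => t1.
  by apply: halts_weaken (next_productive _); lia.
exec; case: ltnP => cn_cnt.
  by apply: halts_weaken (next_unproductive _); lia.
by apply: halts_weaken (next_productive _); lia.
Qed.

(** The reading head stays at [p]: the child is read again as its own single leaf. *)
Lemma exec_leaf_header M p x7 x8 T S cE cN cEN i t cnt cn j k b : M p = 0 ->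
    (forall x7 x8, halts w decider
      (tree_state 28 p x7 x8 T S cE cN cEN i 0 1 0 0 M) k b) ->
  halts w decider
    (tree_state 20 p x7 x8 T S cE cN cEN i t cnt cn j M) (8 + k) b.
Proof.
move=> Mp hk; rewrite /tree_state; exec; exec; first by lia.
exec; first by lia.
exec; first by lia.
by exec; rewrite Mp; apply: halts_weaken (hk _ _); lia.
Qed.

Lemma exec_inner_header M p x7 x8 T S cE cN cEN i t cnt cn j k b :
    M p != 0 -> p + 2 < 2 ^ w ->
    (forall x7 x8, halts w decider
      (tree_state 28 (p + 2) x7 x8 T S cE cN cEN i (M p) (M (p + 1)) 0 0 M) k b) ->
  halts w decider
    (tree_state 20 p x7 x8 T S cE cN cEN i t cnt cn j M) (8 + k) b.
Proof.
move=> Mp p_lt hk; rewrite /tree_state; exec; exec; first by lia.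
exec; first by lia.
exec; first by lia.
exec; rewrite (negbTE Mp).
exec; first by lia.
exec; exec; first by lia.
exact: hk.
Qed.

Section Children.
Variable sigma : nat.
Hypothesis sigma_le : sigma <= 2 ^ w.
Implicit Types (e : regexp 'I_sigma) (es : seq (regexp 'I_sigma)).

Lemma exec_child e M p x7 x8 T S cE cN cEN i t cnt cn j k b :
    let n := nullable e in
    let pr := productive (letter_of_A in_A) e in
    table M -> shallow e -> holds M p (encode e) ->
    p + size (encode e) < 2 ^ w ->
    cE <= i -> cN <= i -> cEN <= i -> i.+1 < 2 ^ w ->
    (forall x7 x8 t cnt cn j, halts w decider
      (tree_state 52 (p + size (encode e)) x7 x8 T S (cE + n) (cN + pr)
         (cEN + (n || pr)) i.+1 t cnt cn j M) k b) ->
  halts w decider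
    (tree_state 20 p x7 x8 T S cE cN cEN i t cnt cn j M)
    (13 * leaves e + 18 + k) b.
Proof.
(* Eight steps for the header, 13 per leaf, ten for the counts. *)
have budget x : 13 * x + 18 + k = 8 + (13 * x + (10 + k)) by lia.
move=> n pr tM sh_e hM p_lt cE_le cN_le cEN_le i_lt hk.
have [l [s [[def_enc def_s l1 l0 l_lt] [def_n def_pr ->]]]] := shallowP in_A sh_e.
have l_lt_w : all (ltn^~ (2 ^ w)) l.
  by apply: sub_all l_lt => a /leq_trans; apply.
have label_le : label e <= 4 by case: (e).
have size_enc : size (encode e) = size s + 2 * size l.
  by rewrite def_enc size_cat size_encode_leaves.
move: hM; rewrite def_enc holds_cat => -[hs hl].
have next x7' x8' : halts w decider
    (tree_state 28 (p + size s) x7' x8' T S cE cN cEN i (label e) (size l) 0 0 M)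
    (13 * size l + (10 + k)) b.
  apply: exec_leaves => //; rewrite -?addnA -?size_enc //; first by lia.
  move=> y7 y8; apply: exec_counts => //; rewrite add0n -def_n -def_pr.
  exact: hk.
rewrite budget.
case: (boolP (is_leaf e)) => leaf_e.
  move: next; rewrite def_s leaf_e addn0 l1 // => next.
  rewrite (_ : label e = 0) in next; last by case: (e) leaf_e.
  apply: exec_leaf_header; last exact: next.
  move: hl; rewrite def_s leaf_e addn0 => hl; rewrite -[p]addn0 hl.
    by case: (l) l0.
  by rewrite size_encode_leaves (l1 leaf_e).
rewrite def_s (negbTE leaf_e) in hs next size_enc.
have Mp : M p = label e by rewrite -[p]addn0 hs.
apply: exec_inner_header; first by rewrite Mp; case: (e) leaf_e.
  by apply: leq_ltn_trans p_lt; rewrite size_enc leq_add2l leq_addr.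
by rewrite Mp hs.
Qed.

Lemma exec_children es M p x7 x8 T S cE cN cEN i t cnt cn j k b :
    let n := @nullable 'I_sigma in
    let pr := productive (@letter_of_A in_A sigma) in
    let s := flatten (map (@encode _) es) in
    table M -> 0 < size es -> all (@shallow _) es -> holds M p s ->
    p + size s < 2 ^ w ->
    cE <= i -> cN <= i -> cEN <= i -> i + size es = S -> S < 2 ^ w ->
    (forall p x7 x8 t cnt cn j, halts w decider
      (tree_state 53 p x7 x8 T S (cE + count n es) (cN + count pr es)
         (cEN + count (fun e => n e || pr e) es) S t cnt cn j M) k b) ->
  halts w decider
    (tree_state 20 p x7 x8 T S cE cN cEN i t cnt cn j M)
    (32 * sumn (map (@leaves _) es) + k) b.
Proof.
move=> n pr s tM; rewrite {}/s.
elim: es p x7 x8 cE cN cEN i t cnt cn j => // e es IH.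
move=> p x7 x8 cE cN cEN i t cnt cn j _ /= /andP [sh_e sh_es].
rewrite holds_cat size_cat => -[he hes] p_lt cE_le cN_le cEN_le def_S S_lt hk.
have := shallow_leaves_gt0 sh_e => e_pos.
(* Beyond 13 steps per leaf, a child costs 18 steps and the loop jump; its first leaf pays for these
   19. *)
apply: (@halts_weaken _ _ _
  (13 * leaves e + 18 + (32 * sumn (map (@leaves _) es) + k).+1)); first by lia.
apply: exec_child => //; try by lia.
move=> y7 y8 t' cnt' cn' j'; rewrite /tree_state; exec.
case: es => [|e' es] in IH sh_es hes p_lt def_S hk *.
  rewrite (_ : (_ < _) = false); last by move: def_S => /=; lia.
  move: (hk (p + size (encode e)) y7 y8 t' cnt' cn' j') => /=.
  by rewrite !addn0 muln0 (_ : i.+1 = S) //; move: def_S => /=; lia.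
rewrite (_ : (_ < _) = true); last by move: def_S => /=; lia.
apply: IH => //; try by move: p_lt def_S => /=; lia.
by move=> *; rewrite -!addnA; apply: hk.
Qed.

(** Cell 0 holds the label of the root of A, 3 for a plus and 4 for a star; the empty word is in the
    language of A only in the latter case. *)
Lemma exec_answer M p x7 x8 T S cE cN cEN i t cnt cn j :
    let n := (T == 4) || (if T == 1 then cE == S else 0 < cE) in
    let pr := (0 < cN) && ((1 < T) || (cEN == S)) in
    0 < T -> 3 <= M 0 <= 4 -> cE <= S ->
  halts w decider
    (tree_state 53 p x7 x8 T S cE cN cEN i t cnt cn j M) 12
    (pr || (M 0 == 4) && n).
Proof.
move=> n pr T_pos /andP [M0_ge M0_le] cE_le.
(* Address 64 is the end of the program, and register 0 still holds its initial 0. *)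
have reject x7' k : halts w decider
    (tree_state 64 p x7' x8 T S cE cN cEN i t cnt cn j M) k false.
  exact: (@halts_weaken _ _ _ 0).
have accept x7' k : halts w decider
    (tree_state 63 p x7' x8 T S cE cN cEN i t cnt cn j M) k.+1 true.
  apply: (@halts_weaken _ _ _ 1) => //.
  by rewrite /tree_state; exec; first exact: ltn_trans w_ge4.
have unproductive : halts w decider
    (tree_state 56 p x7 x8 T S cE cN cEN i t cnt cn j M) 9 ((M 0 == 4) && n).
  rewrite /tree_state; exec; exec; case: ltnP => M04.
    by rewrite ltn_eqF //; apply: reject.
  rewrite [M 0 == 4]eqn_leq M0_le M04 /= /n.
  exec; case: (T =P 4) => T4; first exact: accept.
  exec; case: (T =P 1) => T1 /=.
    exec; case: ltnP => cE_S; first by rewrite ltn_eqF //; apply: reject.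
    by rewrite eqn_leq cE_le cE_S; apply: accept.
  exec; case: ltnP => cE_0; first exact: accept.
  by exec; apply: reject.
rewrite /tree_state; exec; rewrite /pr lt0n; case: (cN =P 0) => cN0 /=.
  exact: halts_weaken unproductive.
exec; case: ltnP => T1; first exact: accept.
exec; case: (cEN =P S) => hEN; first exact: accept.
exact: halts_weaken unproductive.
Qed.

End Children.

End Decider.

(** * Tabulating the letters of A in uninitialised memory *)

Section Table.
Variables (w sigma : nat) (sA r : seq nat).
Hypothesis w_ge4 : 4 < 2 ^ w.
Hypothesis input_fits : 4 + 2 * size sA + size r + sigma <= 2 ^ w.
Hypothesis sA_lt : all (ltn^~ sigma) sA.
Implicit Types (M : nat -> nat) (l : seq nat).

Let top := 2 ^ w - 1.

(* The letter at addresses [p], [p + 1] is copied over the zero at [p], so that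
   after the scan every cell of the scanned region holds a letter of A.  A
   pointer into this region found in the table is thus correct as soon as its
   target is the letter looked up, whatever the table held initially. *)
Definition table_upto (seen rest : seq nat) M :=
  [/\ forall q, 4 <= q < 4 + 2 * size seen -> M q \in seen,
      forall a, a \in seen ->
        4 <= M (top - a) < 4 + 2 * size seen /\ M (M (top - a)) = a &
      holds M (4 + 2 * size seen) (encode_leaves rest ++ r)].

Lemma table_upto_nil M : holds M 4 (encode_leaves sA ++ r) -> table_upto [::] sA M.
Proof. by split=> // q /andP [/leq_ltn_trans h /h]. Qed.

(** A repeated letter merely has its entry redirected to the newer copy. Other entries sit at other
    addresses, and their targets lie in the part already scanned. *)
Lemma table_upto_rcons seen a rest M : seen ++ a :: rest = sA ->
    let p := 4 + 2 * size seen in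
    table_upto seen (a :: rest) M ->
  table_upto (rcons seen a) rest
    [eta [eta M with p |-> M (p + 1)] with top - M (p + 1) |-> p].
Proof.
move=> def_sA p [scanned found unscanned].
have size_sA : size sA = size seen + (size rest).+1 by rewrite -def_sA size_cat.
have Mp : M (p + 1) = a by rewrite unscanned.
have lt_sigma b : b \in sA -> b < sigma by move/(allP sA_lt).
have a_lt : a < sigma by apply: lt_sigma; rewrite -def_sA mem_cat mem_head orbT.
(* Table entries lie beyond the whole input, so writing them damages neither A nor B. *)
have le_top b : b < sigma -> 4 + 2 * size sA + size r <= top - b by rewrite /top; lia.
have top_a := le_top _ a_lt.
have p_ne : p != top - a by rewrite /p; lia.
have p1_ne : p.+1 != top - a by rewrite /p; lia.
rewrite Mp; split=> [q|b|].
- rewrite size_rcons mem_rcons inE /= => q_range.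
  rewrite (_ : (q == top - a) = false); last by lia.
  case: (q =P p) => [|q_p]; first by rewrite eqxx.
  case: (q =P p.+1) => [->|q_p1]; first by rewrite -addn1 Mp eqxx.
  by rewrite scanned ?orbT //; rewrite /p in q_p q_p1; lia.
- rewrite size_rcons mem_rcons inE /=; case: (b =P a) => [->|b_a] /= b_seen.
    by rewrite !eqxx (negbTE p_ne) /p; split=> //; lia.
  have b_lt : b < sigma by apply: lt_sigma; rewrite -def_sA mem_cat b_seen.
  have top_b := le_top _ b_lt.
  rewrite (_ : (top - b == top - a) = false); last by rewrite /top in top_b top_a *; lia.
  rewrite (_ : (top - b == p) = false); last by rewrite /p; lia.
  have [q_range ->] := found _ b_seen; split; first by lia.
  by rewrite !ifN //; rewrite /p; lia.
- rewrite size_rcons => i i_lt /=; have : i < size (encode_leaves rest ++ r) := i_lt.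
  rewrite size_cat size_encode_leaves => i_lt'.
  rewrite !ifN; try by rewrite /p; lia.
  have := unscanned (i + 2); rewrite (_ : _ + (i + 2) = 4 + 2 * (size seen).+1 + i); last by lia.
  by move=> ->; rewrite ?size_cat ?addn2 // size_encode_leaves /=; lia.
Qed.

(** Every scanned cell holds a letter of A, so even an arbitrary initial entry passes the test only
    for a letter of A. *)
Lemma table_upto_table M : table_upto sA [::] M ->
  table w (size sA) (mem sA) M /\ holds M (4 + 2 * size sA) r.
Proof.
move=> [scanned found unscanned]; split=> // a a_lt q; apply/idP/and3P.
  by move=> /found [/andP [q_ge q_lt] ->]; split=> //; rewrite -/top -/q in q_lt *; lia.
by move=> [q_ge q_le /eqP <-]; apply: scanned; lia.
Qed.

Lemma exec_table (rest seen : seq nat) M x7 x8 k b :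
    rest != [::] -> seen ++ rest = sA -> table_upto seen rest M ->
    (forall M' x7 x8, table w (size sA) (mem sA) M' -> M' 0 = M 0 ->
      holds M' (4 + 2 * size sA) r ->
      halts w decider (tree_state w (size sA) 16 (4 + 2 * size sA) x7 x8
                         0 0 0 0 0 0 0 0 0 0 M') k b) ->
  halts w decider
    (tree_state w (size sA) 9 (4 + 2 * size seen) x7 x8 0 0 0 0 0 0 0 0 0 0 M)
    (7 * size rest + k) b.
Proof.
elim: rest seen M x7 x8 => // a rest IH seen M x7 x8 _ def_sA upto_M hk.
have upto_M' := table_upto_rcons def_sA upto_M.
have size_sA : size sA = size seen + (size rest).+1 by rewrite -def_sA size_cat.
have [_ _ unscanned] := upto_M.
have Mp : M (4 + 2 * size seen + 1) = a by rewrite unscanned.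
have a_lt : a < sigma.
  by apply: (allP sA_lt); rewrite -def_sA mem_cat mem_head orbT.
have -> : 7 * size (a :: rest) + k = 7 + (7 * size rest + k) by rewrite /=; lia.
rewrite /tree_state; exec; first by lia.
exec; exec; exec; first by rewrite Mp; lia.
exec; exec; first by lia.
exec; rewrite -/top; set M' := (X in state _ _ X).
(* The label of A must survive the scan, as the final test reads it. *)
have M'0 : M' 0 = M 0.
  by rewrite /M' /= !ifN // Mp /top; lia.
rewrite (_ : 4 + 2 * size seen + 2 = 4 + 2 * size (rcons seen a)); last first.
  by rewrite size_rcons; lia.
case: (boolP (rest == [::])) => [/eqP rest0|rest_nil].
  rewrite rest0 in def_sA size_sA upto_M' *.
  rewrite (_ : (_ < _) = false) /=; last by rewrite size_rcons size_sA /=; lia.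
  rewrite -cats1 def_sA in upto_M' *.
  have [tM' hM'] := table_upto_table upto_M'.
  exact: hk.
rewrite (_ : (_ < _) = true) /=; last first.
  have : 0 < size rest by rewrite lt0n size_eq0.
  by rewrite size_rcons size_sA; lia.
apply: IH => //; first by rewrite cat_rcons.
by move=> M'' y7 y8 tM'' M''0; apply: hk; rewrite // M''0.
Qed.

End Table.

(** * The shape of homogeneous inputs and the language of A *)

Section Inputs.
Variable sigma : nat.
Implicit Types (A B e f : regexp 'I_sigma) (l x : seq 'I_sigma).

(** Depth exactly 3 rules out a letter directly below the root. *)
Lemma homogeneous_letters A :
    homogeneous OpPlus OpUnion A \/ homogeneous OpStar OpUnion A ->
  exists2 l, l != [::] & A = Plus (Union (map (@Letter _) l)) \/
                         A = Star (Union (map (@Letter _) l)).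
Proof.
have letters (f : regexp 'I_sigma) : well_formed f -> depth f == 2 ->
    is_leaf f || labelled OpUnion f && all (@is_leaf _) (children f) ->
    exists2 l, l != [::] & f = Union (map (@Letter _) l).
  case: f => //= es /andP [es0 _] _ /all_is_leaf [l def_es].
  by exists l; rewrite ?def_es // -size_eq0 -(size_map (@Letter _)) -def_es -lt0n.
case=> /and4P []; case: A => //= f wf _ df; rewrite andbT => hf.
  by have [l l0 ->] := letters f wf df hf; exists l; auto.
by have [l l0 ->] := letters f wf df hf; exists l; auto.
Qed.

Lemma homogeneous_shallow t1 t2 B : homogeneous t1 t2 B ->
  [/\ ~~ is_leaf B, 0 < size (children B), all (@shallow _) (children B) &
      leaves B = sumn (map (@leaves _) (children B))].
Proof.
have node (e : regexp 'I_sigma) : well_formed e -> ~~ is_leaf e ->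
    (0 < size (children e)) && all (@well_formed _) (children e).
  by case: e => //= e ->.
move=> /and4P [wf lab _ hch].
have leafN o (e : regexp 'I_sigma) : labelled o e -> ~~ is_leaf e.
  by case: o; case: e.
have leafB := leafN _ _ lab; have /andP [-> wf_ch] := node _ wf leafB.
split=> //; last by case: (B) leafB => //= *; rewrite addn0.
elim: (children B) wf_ch hch => //= e es IH /andP [wf_e /IH IHes].
move=> /andP [he /IHes ->]; rewrite andbT /shallow.
case: (boolP (is_leaf e)) he => //= leaf_e /andP [_ ->].
by have /andP [-> _] := node _ wf_e leaf_e.
Qed.

Lemma lang_pow_letters l n x :
  lang_pow (lang (Union (map (@Letter _) l))) n x <->
  size x = n /\ all (mem l) x.
Proof.
have langU y : lang (Union (map (@Letter _) l)) y <->
    exists2 a, a \in l & y = [:: a].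
  elim: l => /= [|a l IH]; first by split=> // -[].
  split=> [[->|/IH [b b_l ->]]|[b]].
  - by exists a; rewrite ?mem_head.
  - by exists b; rewrite // inE b_l orbT.
  - by rewrite inE => /predU1P [-> ->|b_l y_b]; [left|right; apply/IH; exists b].
elim: n x => [|n IH] x.
  by split=> [->|[/size0nil -> _]].
split=> [[y [z [-> /langU [a a_l ->] pow_z]]]|].
  by have [<- hz] := (IH z).1 pow_z; rewrite /= a_l.
case: x => [|a x] /= [] // [size_x] /andP [a_l x_l].
by exists [:: a], x; split=> //; [apply/langU; exists a|apply: (IH x).2].
Qed.

(** The exponent of a power of single letters is the length of the word, so requiring it to be
    positive excludes just the empty word. *)
Lemma lang_letters A l :
    A = Plus (Union (map (@Letter _) l)) \/
    A = Star (Union (map (@Letter _) l)) ->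
  forall x, lang A x <-> all (mem l) x /\ (x = [::] -> label A == 4).
Proof.
case=> -> x; split.
- move=> [n n_pos /lang_pow_letters [size_x x_l]]; split=> // x0.
  by rewrite x0 in size_x; rewrite -size_x in n_pos.
- move=> [x_l x0]; exists (size x); last exact/lang_pow_letters.
  by case: x {x_l} x0 => // /(_ erefl).
- by move=> [n /lang_pow_letters []].
- by move=> [x_l _]; exists (size x); apply/lang_pow_letters.
Qed.

End Inputs.

Theorem theorem6 (t1 t2 : op) (ht : t1 <> t2) (k : nat) :
  exists (P : program) (C kappa : nat),
  forall (m n sigma w : nat) (A B : regexp 'I_sigma),
    homogeneous OpPlus OpUnion A \/ homogeneous OpStar OpUnion A ->
    homogeneous t1 t2 B ->
    leaves A = m ->
    leaves B = n ->
    sigma <= (m + n) ^ k ->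
    (m + n) ^ kappa <= 2 ^ w ->
    decides_within w P (encode A ++ encode B)
      (exists x : seq 'I_sigma, lang A x /\ lang B x)
      (C * (m + n)).
Proof.
(* The run takes at most 25 + 7m + 32n steps with [m] and [n] positive. The exponent [k + 4] makes
   room for the input and, beyond it, one table entry per letter of the alphabet. *)
exists decider, 64, (k + 4) => m n sigma w A B hA hB def_m def_n sigma_le w_ge.
move=> M [_ hM] final.
have [l l0 def_A] := homogeneous_letters hA.
have lang_A := lang_letters def_A.
have [leafB ch0 sh_ch leavesB] := homogeneous_shallow hB.
have enc_A : encode A = [:: label A; 1; 2; size l] ++ encode_leaves (map val l).
  by case: def_A => ->; rewrite /= size_map encode_letters.
have size_l : size l = m.
  rewrite -def_m; case: def_A => -> /=; elim: (l) => //= a l' ->; lia.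
have label_A : 3 <= label A <= 4 by case: def_A => ->.
set sA := map val l in enc_A *.
have size_sA : size sA = m by rewrite size_map.
pose in_A : pred nat := mem sA.
have in_AE (a : 'I_sigma) : letter_of_A in_A a = (a \in l).
  by rewrite /letter_of_A /in_A /= mem_map //; apply: val_inj.
have enc_B := encode_node leafB.
have size_B : size (encode B) <= 2 + 4 * n.
  by rewrite enc_B /= -def_n leavesB; have := size_encode_children sh_ch; lia.
have size_B2 : 1 < size (encode B) by rewrite enc_B.
have m_pos : 0 < m by rewrite -size_l; case: (l) l0.
have n_pos : 0 < n.
  rewrite -def_n leavesB; case: (children B) ch0 sh_ch => //= e es _.
  by move=> /andP [/shallow_leaves_gt0 e_pos _]; lia.
have [fits n_lt] : 4 + 2 * m + size (encode B) + sigma < 2 ^ w /\ n < 2 ^ w.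
  suff : 4 + 2 * m + size (encode B) + sigma + n < 2 ^ w by lia.
  (* With N = m + n >= 2 and K = N ^ k, the sum is below 8KN, and 8 <= N ^ 3. *)
  apply: leq_trans w_ge; rewrite expnD.
  have N_ge2 : 1 < m + n by lia.
  have N3_ge8 : 2 ^ 3 <= (m + n) ^ 3 by rewrite leq_exp2r.
  have := expn_gt0 (m + n) k; rewrite (_ : 0 < m + n) /=; last by lia.
  move: ((m + n) ^ k) sigma_le => K sigma_le K_pos.
  have : 8 * (K * (m + n)) <= K * (m + n) ^ 4.
    by rewrite (expnD _ 3 1) expn1 mulnCA leq_mul2l leq_mul2r N3_ge8 !orbT.
  have : m + n <= K * (m + n) by rewrite leq_pmull.
  have : K * 2 <= K * (m + n) by rewrite leq_mul2l N_ge2 orbT.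
  by lia.
have w_ge4 : 4 < 2 ^ w by lia.
(* A common word is either nonempty, and then only its letters matter to A, or empty, and then A is
   a star and B is nullable. *)
suff [hf accf] : halts w decider (Config 0 (fun=> 0) M) (64 * (m + n))
    (productive (letter_of_A in_A) B || (label A == 4) && nullable B).
  split=> //; rewrite accf; split=> [|[x [/lang_A [x_l x0] Bx]]].
    case: (boolP (productive _ B)) => [/productiveP [x [Bx x0 x_l]] _|_] /=.
      exists x; split=> //; apply/lang_A; split=> //.
      by rewrite -(eq_all in_AE).
    case: (boolP (_ && _)) => // /andP [star_A /nullableP B0] _.
    by exists [::]; split=> //; apply/lang_A.
  rewrite (_ : _ || _ = true) //; apply/orP; case: (x =P [::]) => [x_nil|x_ne].
    by right; rewrite x0 //; apply/nullableP; rewrite -x_nil.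
  by left; apply/productiveP; exists x; rewrite (eq_all in_AE).
(* One explicit zero for each of the registers 0 to 19. *)
have -> : (fun=> 0) = nth 0 (nseq 20 0) :> (nat -> nat).
  by apply: functional_extensionality => i; rewrite nth_nseq if_same.
have hAB : holds M 0 ([:: label A; 1; 2; m] ++ encode_leaves sA ++ encode B).
  by move=> i; rewrite catA -[in size _]size_l -[in nth _ _]size_l -enc_A => /hM.
have [hA0 hAB4] := (holds_cat _ _ _ _).1 hAB.
(* Nine steps of initialisation, 7 per letter of A, 4 for the root of B, 32 per leaf of B, 12 for
   the answer. *)
apply: (@halts_weaken _ _ _ (9 + (7 * m + (4 + (32 * n + 12))))); first by lia.
rewrite -/(state _ _ _).
exec; first by lia.
exec; first by lia.
exec; first by lia.
apply: exec_sub_wrap => //; rewrite /= add0n.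
exec; first by lia.
(* Cell 3 is the number of children of the union in A, that is [m]. *)
exec; rewrite (hA0 3) //=.
exec; first by lia.
exec; first by lia.
exec; first by lia.
rewrite (_ : m + m + 3 = 2 * m + 3); last by lia.
have := @exec_table w sigma sA (encode B) w_ge4 _ _ sA [::] M 3 0.
rewrite size_sA; apply=> //.
- by lia.
- by apply/allP => _ /mapP [a _ ->]; exact: ltn_ord.
- by rewrite /sA; case: (l) l0.
- exact: table_upto_nil.
move=> M' x7 x8 tM' M'0 hB'; rewrite enc_B in hB'.
have [hroot hch] := (holds_cat _ _ [:: _; _] _).1 hB'.
rewrite /tree_state; exec; exec; first by lia.
exec; exec; first by lia.
have -> : M' (4 + 2 * m) = label B by have := hroot 0; rewrite addn0; apply.
rewrite (hroot 1) // [nth _ _ _]/= -def_n leavesB.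
have M'0A : M' 0 = label A by rewrite M'0 (hA0 0).
have size_children : size (children B) <= n.
  rewrite -def_n leavesB; elim: (children B) sh_ch => //= e es IH.
  by move=> /andP [/shallow_leaves_gt0 e_pos /IH]; lia.
apply: (@exec_children w m in_A w_ge4 sigma) => //; try by lia.
  by move: fits; rewrite enc_B /=; lia.
move=> *; rewrite !add0n productive_node // nullable_node // -M'0A.
apply: exec_answer => //.
- by case: (B) leafB.
- by rewrite M'0A.
- exact: count_size.
Qed.
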